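(* Let $f:\{0,1\}^n\to\{0,1\}$ have alternation number $\operatorname{alt}(f)=k$. Then \[bs(f)\le O\!\left(k\max\{\mathsf N(f)^2,\mathsf N(\overline f)^2\}\right).\]
   Context: $\mathsf N(f)$ is the minimum degree of a real polynomial $p$ with $|p(x)|\le1/3$ whenever $f(x)=0$ and $|p(x)|\ge1$ whenever $f(x)=1$; $\overline f=1-f$. A monotone path is a sequence in $\{0,1\}^n$ where each next point is obtained by changing one coordinate from $0$ to $1$; its alternation number is the number of consecutive pairs on which $f$ changes value. $\operatorname{alt}(f)$ is the maximum alternation number over monotone paths from $0^n$ to $1^n$. $bs(f)$ is block sensitivity. Constants in $O(\cdot)$ are absolute. *)

(* Defs.v *)
From HB Require Import structures.
From mathcomp Require Import all_boot all_order all_algebra.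
From mathcomp Require Import reals.
From mathcomp Require Import mpoly.

Set Implicit Arguments.
Unset Strict Implicit.
Unset Printing Implicit Defensive.

Import Order.TTheory GRing.Theory Num.Theory.

Definition cube (n : nat) := {ffun 'I_n -> bool}.
Definition boolfun (n : nat) := cube n -> bool.

Definition zeros (n : nat) : cube n := [ffun _ => false].
Definition ones (n : nat) : cube n := [ffun _ => true].

Definition negf (n : nat) (f : boolfun n) : boolfun n := fun x => ~~ f x.

Definition mstep (n : nat) (x y : cube n) : bool :=
  [exists i : 'I_n, ~~ x i && (y == [ffun j => if j == i then true else x j])].

Definition monpath (n : nat) (s : seq (cube n)) : bool :=
  path (@mstep n) (zeros n) s && (last (zeros n) s == ones n).

Definition altnum (n : nat) (f : boolfun n) (s : seq (cube n)) : nat :=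
  count id (pairmap (fun a b => f a != f b) (zeros n) s).

Definition is_alt (n : nat) (f : boolfun n) (k : nat) : Prop :=
  (exists s, monpath s /\ altnum f s = k) /\
  (forall s, monpath s -> (altnum f s <= k)%N).

Definition flipB (n : nat) (x : cube n) (B : {set 'I_n}) : cube n :=
  [ffun i => if i \in B then ~~ x i else x i].

Definition sens_blocks (n : nat) (f : boolfun n) (x : cube n)
    (F : {set {set 'I_n}}) : bool :=
  [&& trivIset F, set0 \notin F & [forall B in F, f (flipB x B) != f x]].

Definition bs_at (n : nat) (f : boolfun n) (x : cube n) : nat :=
  \max_(F : {set {set 'I_n}} | sens_blocks f x F) #|F|.

Definition bs (n : nat) (f : boolfun n) : nat := \max_(x : cube n) bs_at f x.

Local Open Scope ring_scope.

Definition cube_pt (R : realType) (n : nat) (x : cube n) : 'I_n -> R :=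
  fun i => (x i)%:R.

Definition Napprox (R : realType) (n : nat) (f : boolfun n) (d : nat) : Prop :=
  exists p : {mpoly R[n]},
    (msize p <= d.+1)%N /\
    forall x : cube n,
      if f x then 1 <= `| p.@[cube_pt R x] |
      else `| p.@[cube_pt R x] | <= 3^-1.

Definition is_N (R : realType) (n : nat) (f : boolfun n) (d : nat) : Prop :=
  Napprox R f d /\ forall d', Napprox R f d' -> (d <= d')%N.

(* Main.v *)
(** Fix [x] and disjoint sensitive blocks [B j].  Let [block_pt S T] be [x] after
    setting to 1 the zeros of [x] in the blocks of [S] and to 0 the ones of [x] in
    the blocks of [T]; it increases with [S] and decreases with [T], so alternations
    of [g S T = f (block_pt S T)] along such moves are alternations of [f] along a
    monotone path.

    - If [f] takes the opposite of its value at a point after flipping any nonempty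
      union of [r] disjoint blocks, then symmetrization followed by Lagrange
      extrapolation gives [r <= m = 10 d^2], where [d] is the larger of the two
      degrees.  Hence, walking down from a set [A] greedily (always to a largest
      subset where the value changes) one reaches, after [l] alternations and the
      loss of at most [m l] elements, a set below which [g] is constant.
    - After two such walks [g S 0 = g 0 T = c] for all [S] and [T], whereas
      [g {j} {j} = ~~ c].  Moving [j] into [S] gains an alternation, but kills the
      blocks [i] with [g {i,j} {i} = c]; making [g {j} ({j} + T)] constant gains
      about as many alternations as [1/m] times the number of [i] with
      [g {j} {i,j} = c], the killers of [j] on the [T] side.  Moving [j] into [T] is
      symmetric.  Summed over [j], the killed and the killers balance, so some move
      kills no more than it pays for, and induction gives [2 m k] blocks at most. *)

Require Import Defs.
From HB Require Import structures.
From mathcomp Require Import all_boot all_order all_algebra.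
From mathcomp Require Import reals.
From mathcomp Require Import mpoly.
From mathcomp Require Import zify ring lra.

Set Implicit Arguments.
Unset Strict Implicit.
Unset Printing Implicit Defensive.

Import Order.TTheory GRing.Theory Num.Theory.

(** * Alternations over pairs of sets of blocks *)

(** Bookkeeping for [rich_step], showing where the factor 2 goes. The [s1] alternations pay once for
    the elements lost in the first descent and once for the [t] killers. The [q] alternations pay
    for the second loss and, as [q] is positive, for the moved block, which is the extra 1 in
    [a.+1]. *)
Lemma rich_step_count m a w w' a' k t s1 s2 q l :
    0 < m -> 0 < q -> s2 <= q -> a <= w + m * s1 -> w <= w' + m * s2 ->
    w' <= a' + k -> a' <= 2 * m * l -> t <= m * s1 ->
  a.+1 + t <= 2 * m * (s1 + q + l) + k.
Proof.
move=> m0 q0 sq ha hw hw' ha' ht.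
have h1 : m * s2 <= m * q by rewrite leq_mul2l sq orbT.
have h2 : 0 < m * q by rewrite muln_gt0 m0.
lia.
Qed.

Section AlternatingChains.
Variable I : finType.
Implicit Types (g : {set I} -> {set I} -> bool) (S T A B D W X : {set I}).

(* [g] changes value at least [l] times while [S] grows and [T] shrinks. *)
Inductive alternates g : nat -> {set I} -> {set I} -> {set I} -> {set I} -> Prop :=
| alternates_le S T S' T' :
    S \subset S' -> T' \subset T -> alternates g (g S T != g S' T') S T S' T'
| alternates_cat l l' S T S' T' S'' T'' :
    alternates g l S T S' T' -> alternates g l' S' T' S'' T'' ->
    alternates g (l + l') S T S'' T''.

Definition dualg g S T := g T S.

(** Swapping the arguments exchanges growing with shrinking, so the chain is read backwards; the
    number of changes does not depend on the direction. *)
Lemma alternates_dual g l S T S' T' :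
  alternates (dualg g) l S T S' T' -> alternates g l T' S' T S.
Proof.
elim=> {l S T S' T'} [S T S' T' sS sT|l l' S T S' T' S'' T'' _ h1 _ h2].
  by rewrite eq_sym; apply: alternates_le.
by rewrite addnC; apply: alternates_cat h2 h1.
Qed.

Lemma alternates_catl g k l S T S' T' S'' T'' :
  alternates g l S T S' T' -> S' \subset S'' -> T'' \subset T' ->
  k = (g S' T' != g S'' T'') + l -> alternates g k S T S'' T''.
Proof. by move=> h sS sT ->; rewrite addnC; apply: alternates_cat h _; apply: alternates_le. Qed.

(* The hypothesis is the corner bound of the header, for [h]. *)
Lemma greedy_descent (h : {set I} -> bool) m A :
    (forall D X : {set I}, (forall Y : {set I}, Y \subset X -> Y != set0 -> h (D :|: Y) = ~~ h D) ->
      #|X| <= m) ->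
  exists s,
    [/\ path [rel B D : {set I} | (D \subset B) && (h B != h D)] A s,
        last A s \subset A, #|A| <= #|last A s| + m * size s
      & forall X : {set I}, X \subset last A s -> h X = h (last A s)].
Proof.
move=> hm; have [n leAn] := ubnP #|A|; elim: n A leAn => // n IHn A leAn.
have [/existsP[D0 hD0]|/existsPn cst] :=
  boolP [exists D : {set I}, (D \subset A) && (h A != h D)]; last first.
  exists [::]; split=> //=; first by rewrite muln0 addn0.
  by move=> X sXA; move: (cst X); rewrite sXA /= negbK => /eqP.
pose D := [arg max_(D > D0 | (D \subset A) && (h A != h D)) #|D|].
have [sDA hD maxD] : [/\ D \subset A, h A != h D &
    forall X : {set I}, X \subset A -> h A != h X -> #|X| <= #|D|].
  rewrite /D; case: arg_maxnP => // D' /andP[sD hD] mx; split=> // X sX hX.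
  by apply: mx; rewrite sX.
(* Adding a nonempty part of [A :\: D] to [D] gives a larger subset of [A], where by maximality [h]
   equals [h A], the opposite of [h D]. *)
have corner : #|A :\: D| <= m.
  apply: (hm D) => Y sY /set0Pn[y Yy].
  have : ~~ (#|D :|: Y| <= #|D|).
    rewrite -ltnNge; apply: proper_card; apply/properP; split; first exact: subsetUl.
    exists y; first by rewrite inE Yy orbT.
    by have /setDP[] := subsetP sY _ Yy.
  have sDY : D :|: Y \subset A.
    by rewrite subUset sDA (subset_trans sY (subsetDl _ _)).
  move=> nle; have := maxD _ sDY; case: eqP => [<- _|_ /(_ isT)]; last by rewrite (negbTE nle).
  by move: hD; case: (h A); case: (h D).
have ltDA : #|D| < #|A|.
  apply: proper_card; rewrite properEneq sDA andbT.
  by apply: contraNneq hD => ->.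
have [s [ps sl cs ch]] := IHn D (leq_trans ltDA leAn).
exists (D :: s); split=> //=.
- by rewrite sDA hD.
- exact: subset_trans sl sDA.
- have := cardsID D A; rewrite (setIidPr sDA) => eA.
  by rewrite -eA mulnS; lia.
Qed.

Lemma path_alternates g S T A s :
  path [rel B D : {set I} | (D \subset B) && (g S (T :|: B) != g S (T :|: D))] A s ->
  alternates g (size s) S (T :|: A) S (T :|: last A s).
Proof.
elim: s A => [|D s IHs] A /=.
  by move=> _; have := @alternates_le g _ (T :|: A) _ _ (subxx S) (subxx _); rewrite eqxx.
case/andP=> /andP[sDA hD] /IHs; rewrite -add1n; apply: alternates_cat.
by have := @alternates_le g _ (T :|: A) _ _ (subxx S) (setUS T sDA); rewrite hD.
Qed.

(** Invariant of the induction: [S0] and [T0] hold the blocks already moved, [A] those still in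
    play, each sensitive at the base pair [(S0, T0)]. *)
Definition rich g c S0 T0 A :=
  [/\ forall S, S \subset A -> g (S0 :|: S) T0 = c,
      forall T, T \subset A -> g S0 (T0 :|: T) = c
    & forall j, j \in A -> g (j |: S0) (j |: T0) = ~~ c].

(* Once [i] has been moved into [S0], block [j] is no longer sensitive at [(S0, T0)]. *)
Definition kills g c S0 T0 i j := g (i |: (j |: S0)) (j |: T0) == c.

(* The two cardinals are the killers of [j] on the [T] side and the blocks killed by
   moving [j] into [S]. *)
Lemma rich_step g c m S0 T0 A j :
    0 < m ->
    (forall S T X, (forall Y : {set I}, Y \subset X -> Y != set0 ->
       g S (T :|: Y) = ~~ g S T) -> #|X| <= m) ->
    rich g c S0 T0 A -> j \in A ->
    (forall S T A', rich g c S T A' -> #|A'| < #|A| ->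
       exists2 l, alternates g l S (T :|: A') (S :|: A') T & #|A'| <= 2 * m * l) ->
  exists2 l, alternates g l S0 (T0 :|: A) (S0 :|: A) T0 &
    #|A| + #|[set e in A :\ j | kills (dualg g) c T0 S0 e j]|
      <= 2 * m * l + #|[set i in A :\ j | kills g c S0 T0 j i]|.
Proof.
move=> m0 hm [gS gT gj] Aj IH.
have sjA : [set j] \subset A by rewrite sub1set.
have gj0 : g (j |: S0) T0 = c by rewrite setUC; apply: gS.
(* With [j] on both sides the value at the empty set is [~~ c], hence it is [~~ c] on every subset
   of [W]. *)
have [s1 [ps1 sW1 cW1 kW1]] := @greedy_descent
  (fun X => g (j |: S0) ((j |: T0) :|: X)) m (A :\ j)
  (fun D X hX => hm (j |: S0) ((j |: T0) :|: D) X
    (fun Y sY nY => etrans (congr1 (g _) (esym (setUA _ _ _))) (hX Y sY nY))).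
set W := last _ s1 in sW1 cW1 kW1.
(* With [j] on the [S] side only, the value at the empty set is [c], hence it is [c] on every subset
   of [W']. Discarding the killed blocks [K] then restores the invariant at [(j |: S0, T0)]. *)
have [s2 [ps2 sW2 cW2 kW2]] := @greedy_descent
  (fun X => g (j |: S0) (T0 :|: X)) m W
  (fun D X hX => hm (j |: S0) (T0 :|: D) X
    (fun Y sY nY => etrans (congr1 (g _) (esym (setUA _ _ _))) (hX Y sY nY))).
set W' := last _ s2 in sW2 cW2 kW2.
pose K := [set i in A :\ j | kills g c S0 T0 j i].
pose A' := W' :\: K.
have sA'W' : A' \subset W' by exact: subsetDl.
have sW'j : W' \subset A :\ j by apply: subset_trans sW2 sW1.
have sA'j : A' \subset A :\ j by apply: subset_trans sA'W' sW'j.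
have sA'A : A' \subset A by apply: subset_trans sA'j (subsetDl _ _).
have val1 X : X \subset W -> g (j |: S0) ((j |: T0) :|: X) = ~~ c.
  by move=> sX; rewrite kW1 // -(kW1 set0 (sub0set _)) setU0 gj.
have val2 X : X \subset W' -> g (j |: S0) (T0 :|: X) = c.
  by move=> sX; rewrite kW2 // -(kW2 set0 (sub0set _)) setU0.
have richA' : rich g c (j |: S0) T0 A'.
  split=> [S sS|T sT|i iA'].
  - rewrite (setUC [set j]) -setUA; apply: gS.
    by rewrite subUset sjA (subset_trans sS).
  - by apply: val2; apply: subset_trans sT sA'W'.
  - have := iA'; rewrite /A' /K !inE => /andP[+ iW'].
    have := subsetP sA'j _ iA'; rewrite !inE /= => -> /=.
    rewrite /kills setUCA => /negbTE h; apply/eqP.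
    by move: h; case: (g _ _); case: (c).
have ltA' : #|A'| < #|A|.
  by apply: leq_ltn_trans (subset_leq_card sA'j) _; rewrite (cardsD1 j A) Aj.
have [l' rl' cl'] := IH _ _ _ richA' ltA'.
have cA : #|A| = #|A :\ j|.+1 by rewrite (cardsD1 j A) Aj.
have cW'A' : #|W'| <= #|A'| + #|K|.
  have := cardsID K W'; rewrite -/A' => <-.
  by rewrite addnC leq_add2l subset_leq_card // subsetIr.
(* A killer of [j] on the [T] side gives the value [c], so it cannot lie in [W]: the first descent
   discarded it, and its alternations bound the number of such blocks. *)
have cL : #|[set e in A :\ j | kills (dualg g) c T0 S0 e j]| <= m * size s1.
  apply: leq_trans (_ : #|(A :\ j) :\: W| <= _); last first.
    have := cardsID W (A :\ j); rewrite (setIidPr sW1).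
    by move: cW1; rewrite -/W; lia.
  apply: subset_leq_card; apply/subsetP=> e; rewrite !inE /kills /dualg => /andP[-> /= ].
  rewrite andbT (setUC [set e]); apply: contraL => We.
  by rewrite val1 ?sub1set //; case: (c).
have ps1' := path_alternates ps1.
have ps2' := path_alternates ps2.
rewrite -/W in ps1'; rewrite -/W -/W' in ps2'.
have jA : (j |: T0) :|: (A :\ j) = T0 :|: A.
  by rewrite (setUC [set j]) -setUA setD1K.
rewrite jA in ps1'.
(* The full chain adds [j] to [S], follows the first descent, reaches [T0 :|: W'] with [P]
   alternations, shrinks to [A'], runs the chain given by induction, and fills up [S]. *)
have mono (P : nat) : alternates g P (j |: S0) ((j |: T0) :|: W) (j |: S0) (T0 :|: W') ->
    alternates g ((g S0 (T0 :|: A) != g (j |: S0) (T0 :|: A)) + (size s1 + (P +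
      ((g (j |: S0) (T0 :|: W') != g (j |: S0) (T0 :|: A')) + (l' + 
      (g ((j |: S0) :|: A') T0 != g (S0 :|: A) T0))))))
      S0 (T0 :|: A) (S0 :|: A) T0.
  move=> hP; apply: alternates_cat; first by apply: alternates_le => //; apply: subsetUr.
  apply: alternates_cat ps1' _; apply: alternates_cat hP _.
  apply: alternates_cat; first by apply: alternates_le => //; apply: setUS.
  apply: alternates_cat rl' _; apply: alternates_le => //.
  by rewrite (setUC [set j]) -setUA setUS // subUset sjA sA'A.
(* At least one alternation occurs here even if the second descent is empty: the value passes from
   [~~ c] to [c] when [j] leaves the [T] side. *)
have [q q0 [hq eq2]] : exists2 q, 0 < q & q >= size s2 /\
   alternates g q (j |: S0) ((j |: T0) :|: W) (j |: S0) (T0 :|: W').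
  have sTW : T0 :|: W' \subset j |: T0 :|: W' by apply: setSU; apply: subsetUr.
  case E: (size s2) => [|p].
    exists 1 => //; split=> //.
    have h1 := @alternates_le g _ (j |: T0 :|: W) _ _ (subxx (j |: S0))
      (setUS (j |: T0) sW2).
    apply: alternates_catl h1 _ sTW _ => //.
    by rewrite !val1 // val2 // eqxx; case: (c).
  exists ((g (j |: S0) (j |: T0 :|: W) != g (j |: S0) (T0 :|: W)) + p.+1).
    by rewrite addnS.
  split; first exact: leq_addl.
  rewrite -E; apply: alternates_cat ps2'; apply: alternates_le => //.
  by apply: setSU; apply: subsetUr.
have := mono _ eq2; set l := (X in alternates g X _ _ _ _) => rl.
exists l => //.
have lb : size s1 + q + l' <= l.
  rewrite /l -!addnA; apply: leq_trans (leq_addl _ _); rewrite !leq_add2l.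
  by apply: leq_trans (leq_addl _ _); rewrite leq_addr.
rewrite -/K.
apply: leq_trans (_ : 2 * m * (size s1 + q + l') + #|K| <= _); last first.
  by rewrite leq_add2r leq_mul2l lb orbT.
rewrite cA; exact: rich_step_count m0 q0 hq cW1 cW2 cW'A' cl' cL.
Qed.

Lemma rich_dual g c S0 T0 A : rich g c S0 T0 A -> rich (dualg g) c T0 S0 A.
Proof. by case=> gS gT gj; split. Qed.

Lemma exists_le_sum (A : {set I}) (a b : I -> nat) :
  A != set0 -> \sum_(j in A) a j <= \sum_(j in A) b j ->
  exists2 j, j \in A & a j <= b j.
Proof.
move=> /set0Pn[i Ai] le; apply/exists_inP; apply: contraLR le => /exists_inPn nle.
rewrite -ltnNge (bigD1 i) //= [X in _ < X](bigD1 i) //= -addSn leq_add //.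
  by rewrite ltnNge nle.
by apply: leq_sum => j /andP[Aj _]; rewrite leqNgt -leqNgt ltnW // ltnNge nle.
Qed.

(** Double counting of the ordered pairs of distinct blocks of [A] in which the first kills the
    second. *)
Lemma sum_kills g c S0 T0 A :
  \sum_(j in A) #|[set i in A :\ j | kills g c S0 T0 j i]| =
  \sum_(j in A) #|[set i in A :\ j | kills g c S0 T0 i j]|.
Proof.
have E (P : I -> I -> bool) : \sum_(j in A) #|[set i in A :\ j | P j i]| =
    \sum_(j in A) \sum_(i in A) ((i != j) && P j i).
  apply: eq_bigr => j _; rewrite -sum1_card big_mkcond [RHS]big_mkcond /=.
  by apply: eq_bigr => i _; rewrite !inE; do !case: (_ \in _) => //=; do !case: (_ == _) => //=; case: (P j i).
rewrite !E exchange_big /=; apply: eq_bigr => j _; apply: eq_bigr => i _.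
by rewrite eq_sym.
Qed.

Lemma rich_alternates g c m S0 T0 A :
    0 < m ->
    (forall S T X, (forall Y : {set I}, Y \subset X -> Y != set0 ->
       g S (T :|: Y) = ~~ g S T) -> #|X| <= m) ->
    (forall S T X, (forall Y : {set I}, Y \subset X -> Y != set0 ->
       g (S :|: Y) T = ~~ g S T) -> #|X| <= m) ->
    rich g c S0 T0 A ->
  exists2 l, alternates g l S0 (T0 :|: A) (S0 :|: A) T0 & #|A| <= 2 * m * l.
Proof.
move=> m0 hT hS; have [n] := ubnP #|A|; elim: n S0 T0 A => // n IHn S0 T0 A leAn richA.
have [->|A0] := eqVneq A set0.
  exists (g S0 T0 != g S0 T0); last by rewrite cards0.
  by rewrite !setU0; apply: alternates_le.
pose KS j := #|[set i in A :\ j | kills g c S0 T0 j i]|.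
pose LS j := #|[set i in A :\ j | kills g c S0 T0 i j]|.
pose KT j := #|[set i in A :\ j | kills (dualg g) c T0 S0 j i]|.
pose LT j := #|[set i in A :\ j | kills (dualg g) c T0 S0 i j]|.
have [j Aj le] : exists2 j, j \in A & KS j + KT j <= LS j + LT j.
  by apply: exists_le_sum => //; rewrite !big_split /= !sum_kills.
have IH S T A' : rich g c S T A' -> #|A'| < #|A| ->
    exists2 l, alternates g l S (T :|: A') (S :|: A') T & #|A'| <= 2 * m * l.
  by move=> r lt; apply: IHn => //; apply: leq_trans lt leAn.
(* The terms are compared crosswise: moving [j] into [S] kills [KS j] blocks but is paid by the
   killers [LT j] on the other side, and symmetrically for [T]. *)
have [leS|leT] : KS j <= LT j \/ KT j <= LS j by lia.
  have [l rl hl] := rich_step m0 hT richA Aj IH.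
  by exists l => //; move: hl leS; rewrite /KS /LT; lia.
have [S T A' r lt|l rl hl] := rich_step m0 (g := dualg g)
  (fun S T X hX => hS T S X hX) (rich_dual richA) Aj.
  have [l /= rl hl] := IH _ _ _ (rich_dual r) lt.
  by exists l => //; apply: alternates_dual rl.
exists l; first exact: alternates_dual rl.
have {}hl : #|A| + LS j <= 2 * m * l + KT j := hl.
by lia.
Qed.

(** One descent on the [T] side, then one on the [S] side inside its result, leave a set [A]
    satisfying the invariant at the empty pair; the chain for [A] is inserted between the two
    descents. *)
Lemma block_alternates g m :
    0 < m ->
    (forall S T X, (forall Y : {set I}, Y \subset X -> Y != set0 ->
       g S (T :|: Y) = ~~ g S T) -> #|X| <= m) ->
    (forall S T X, (forall Y : {set I}, Y \subset X -> Y != set0 ->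
       g (S :|: Y) T = ~~ g S T) -> #|X| <= m) ->
    (forall j, g [set j] [set j] = ~~ g set0 set0) ->
  exists2 l, alternates g l set0 setT setT set0 & #|I| <= 2 * m * l.
Proof.
move=> m0 hT hS gj.
have [s1 [p1 sW1 cW1 kW1]] := @greedy_descent (fun X => g set0 (set0 :|: X)) m setT
  (fun D X hX => hT set0 (set0 :|: D) X
    (fun Y sY nY => etrans (congr1 (g _) (esym (setUA _ _ _))) (hX Y sY nY))).
set W := last _ s1 in sW1 cW1 kW1.
have [s2 [p2 sW2 cW2 kW2]] := @greedy_descent (fun X => g (set0 :|: X) set0) m W
  (fun D X hX => hS (set0 :|: D) set0 X
    (fun Y sY nY => etrans (congr1 (g^~ set0) (esym (setUA _ _ _))) (hX Y sY nY))).
set A := last _ s2 in sW2 cW2 kW2.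
have richA : rich g (g set0 set0) set0 set0 A.
  split=> [S sS|T sT|j Aj]; last by rewrite !setU0.
    by rewrite kW2 // -(kW2 set0 (sub0set _)) !setU0.
  have sAW : A \subset W by [].
  by rewrite kW1 ?(subset_trans sT) // -(kW1 set0 (sub0set _)) !setU0.
have [l rl hl] := rich_alternates m0 hT hS richA.
have := path_alternates p1; rewrite -/W !set0U => r1.
(* The second descent shrinks [S]; read backwards it grows [S] from [A] to [W], so it comes after
   the chain for [A]. *)
have := alternates_dual (path_alternates (g := dualg g) p2); rewrite -/A !set0U => r2.
move: rl; rewrite !set0U => rl.
have := alternates_cat r1 (alternates_cat (alternates_le g (subxx set0) sW2)
  (alternates_cat rl (alternates_cat r2 (alternates_le g sW1 (subxx set0))))).
set L := (X in alternates g X _ _ _ _) => rL.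
exists L => //.
have lb : size s1 + l + size s2 <= L.
  rewrite /L -!addnA leq_add2l; apply: leq_trans (leq_addl _ _).
  by rewrite leq_add2l leq_addr.
apply: leq_trans (_ : 2 * m * (size s1 + l + size s2) <= _); last first.
  by rewrite leq_mul2l lb orbT.
move: cW1 cW2; rewrite -/W -/A cardsT !mulnDr; lia.
Qed.

End AlternatingChains.

(** * Symmetrization *)

Section SetFunctions.
Variables (R : realFieldType) (I : finType).
Local Open Scope ring_scope.
Implicit Types (F G : {set I} -> R) (X Y Z E : {set I}).

(** Multilinear polynomials of degree at most [d] in the membership indicators of [Y], generated
    from monomials. The equations are pointwise, so equality of functions is never involved. *)
Inductive low_degree : nat -> ({set I} -> R) -> Prop :=
| low_degree_mono d Z F : (#|Z| <= d)%N -> (forall Y, F Y = (Z \subset Y)%:R) ->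
    low_degree d F
| low_degree_lin d a F G H : low_degree d F -> low_degree d G ->
    (forall Y, H Y = a * F Y + G Y) -> low_degree d H
| low_degree0 d F : (forall Y, F Y = 0) -> low_degree d F.

Lemma eq_low_degree d F G : low_degree d F -> (forall Y, G Y = F Y) -> low_degree d G.
Proof.
move=> hF e; apply: (low_degree_lin (a := 1) hF (low_degree0 d (fun=> erefl 0))) => Y.
by rewrite mul1r addr0.
Qed.

Lemma low_degree_leq d d' F : (d <= d')%N -> low_degree d F -> low_degree d' F.
Proof.
move=> le hF; elim: hF le => {d F} [d Z F cZ e|d a F G H _ hF _ hG e|d F e] le.
- by apply: low_degree_mono e; apply: leq_trans cZ le.
- by apply: low_degree_lin (hF le) (hG le) e.
- exact: low_degree0.
Qed.

Lemma low_degreeM_mem d F j :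
  low_degree d F -> low_degree d.+1 (fun Y => (j \in Y)%:R * F Y).
Proof.
elim=> {d F} [d Z F cZ e|d a F G H _ hF _ hG e|d F e].
- apply: (@low_degree_mono _ (j |: Z)) => [|Y].
    by apply: leq_trans (leq_card_setU _ _) _; rewrite cards1.
  by rewrite e subUset sub1set -natrM mulnb.
- by apply: low_degree_lin hF hG _ => Y /=; rewrite e mulrDr mulrCA.
- by apply: low_degree0 => Y; rewrite e mulr0.
Qed.

(** The affine forms that a coordinate takes as a function of the chosen set of blocks; substituting
    them does not raise the degree. *)
Definition literal (b : {set I} -> bool) :=
  [\/ exists c, forall Y, b Y = c, exists j, forall Y, b Y = (j \in Y)
    | exists j, forall Y, b Y = (j \notin Y)].

Lemma low_degreeM_literal d F b : literal b ->
  low_degree d F -> low_degree d.+1 (fun Y => (b Y)%:R * F Y).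
Proof.
case=> [[c e]|[j e]|[j e]] hF.
- have h0 := low_degree0 d.+1 (fun _ : {set I} => erefl 0).
  apply: (low_degree_lin (a := c%:R) (low_degree_leq (leqnSn d) hF) h0) => Y.
  by rewrite e addr0.
- by apply: eq_low_degree (low_degreeM_mem j hF) _ => Y; rewrite e.
- apply: (low_degree_lin (a := -1) (low_degreeM_mem j hF)
    (low_degree_leq (leqnSn d) hF)) => Y.
  by rewrite e; case: (j \in Y); rewrite ?(mul0r, mul1r, mulr0, mulN1r, addNr, oppr0, add0r).
Qed.

Lemma low_degree_monom (J : Type) (r : seq J) (m : J -> nat) (b : J -> {set I} -> bool) :
    (forall i, literal (b i)) ->
  low_degree (\sum_(i <- r) m i) (fun Y => \prod_(i <- r) (b i Y)%:R ^+ m i).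
Proof.
move=> hb; elim: r => [|i r IHr].
  rewrite big_nil; apply: (@low_degree_mono _ set0); rewrite ?cards0 // => Y.
  by rewrite sub0set big_nil.
(* A bit equals each of its positive powers, so a single multiplication stands for the exponent
   [m i]; exponent 0 contributes the factor 1. *)
rewrite big_cons; case: (posnP (m i)) => [mi0|mi0].
  apply: (@low_degree_leq (\sum_(i <- r) m i)); first exact: leq_addl.
  by apply: eq_low_degree IHr _ => Y; rewrite big_cons mi0 expr0 mul1r.
apply: (@low_degree_leq (\sum_(i <- r) m i).+1); first by rewrite -add1n leq_add2r.
apply: eq_low_degree (low_degreeM_literal (hb i) IHr) _ => Y.
rewrite big_cons; congr (_ * _); case: (b i Y) => /=; first by rewrite expr1n.
by rewrite expr0n -[m i]prednK.
Qed.

Lemma low_degree_meval n d (p : {mpoly R[n]}) (v : {set I} -> 'I_n -> bool) :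
    (msize p <= d.+1)%N -> (forall i, literal (v^~ i)) ->
  low_degree d (fun Y => p.@[fun i => (v Y i)%:R]).
Proof.
move=> sp hv.
suff h : low_degree d (fun Y => \sum_(m <- msupp p) p@_m * \prod_i (v Y i)%:R ^+ m i).
  by apply: eq_low_degree h _ => Y; rewrite mevalE.
have : {subset msupp p <= msupp p} by [].
move: {1 3}(msupp p) => r; elim: r => [|m r IHr] sub.
  by apply: low_degree0 => Y; rewrite big_nil.
have hm : low_degree d (fun Y => \prod_i (v Y i)%:R ^+ m i).
  apply: (@low_degree_leq (\sum_(i <- index_enum 'I_n) m i)); last exact: low_degree_monom.
  rewrite -mdegE -ltnS; apply: leq_trans sp; apply: msize_mdeg_lt.
  by apply: sub; rewrite mem_head.
have sub' : {subset r <= msupp p} by move=> x xr; apply: sub; rewrite inE xr orbT.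
apply: (low_degree_lin (a := p@_m) hm (IHr sub')) => Y.
by rewrite big_cons.
Qed.

(** Removing [Z] is a bijection onto the subsets of [E :\: Z] of size [t - #|Z|]. The guard is there
    because truncated subtraction would make the binomial 1 when [t] is below [#|Z|]. *)
Lemma card_draws_above E Z t : Z \subset E ->
  #|[set Y : {set I} | [&& Y \subset E, #|Y| == t & Z \subset Y]]| =
    ((#|Z| <= t) * 'C(#|E| - #|Z|, t - #|Z|))%N.
Proof.
move=> sZE; case: leqP => [leZt|ltZ]; last first.
  apply/eqP; rewrite mul0n cards_eq0; apply/eqP/setP => Y; rewrite !inE.
  apply/negbTE/and3P => -[_ /eqP cY /subset_leq_card]; lia.
rewrite mul1n.
have <- : #|E :\: Z| = (#|E| - #|Z|)%N by rewrite cardsD (setIidPr sZE).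
rewrite -cards_draws -[RHS](card_in_imset (f := fun Y => Z :|: Y)); last first.
  move=> A B; rewrite !inE => /andP[/subsetDP[_ dA] _] /andP[/subsetDP[_ dB] _] e.
  apply/setP=> x; have /setP/(_ x) := e; rewrite !inE.
  case xZ: (x \in Z) => //= _.
  by rewrite (disjointFl dA xZ) (disjointFl dB xZ).
apply: eq_card => Y; rewrite !inE; apply/and3P/imsetP => [[sY /eqP cY sZ]|[W]].
  exists (Y :\: Z); last by rewrite setDE setUIr setUCr setIT; apply/esym/setUidPr.
  by rewrite !inE setSD //= cardsD (setIidPr sZ) cY.
rewrite !inE => /andP[/subsetDP[sW dW] /eqP cW] ->; split; last exact: subsetUl.
  by rewrite subUset sZE.
have := cardsUI Z W; rewrite setIC (disjoint_setI0 dW) cards0 cW; lia.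
Qed.

(** Division-free form of the probability [t ^_ z / n ^_ z] that a random [t]-subset of [n] points
    contains [z] given ones: a polynomial of degree [z] in [t]. *)
Lemma bin_mul_ffact n t z : (z <= t)%N ->
  ('C(n - z, t - z) * n ^_ z = 'C(n, t) * t ^_ z)%N.
Proof.
move=> zt; case: (leqP t n) => tn; last first.
  rewrite (bin_small tn); case: (leqP z n) => zn; last by rewrite (ffact_small zn) muln0.
  by rewrite bin_small //; lia.
have f0 : (0 < (t - z)`! * (n - t)`!)%N by rewrite muln_gt0 !fact_gt0.
apply/eqP; rewrite -(eqn_pmul2r f0); apply/eqP.
have e1 : ('C(n - z, t - z) * ((t - z)`! * (n - t)`!) = (n - z)`!)%N.
  have -> : (n - t = n - z - (t - z))%N by lia.
  by apply: bin_fact; lia.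
have e2 : (t ^_ z * (t - z)`! = t`!)%N by apply: ffact_fact.
have e3 : (n ^_ z * (n - z)`! = n`!)%N by apply: ffact_fact; lia.
have e4 := bin_fact tn.
rewrite mulnAC e1 mulnC e3 -e4 -e2; ring.
Qed.

(** Minsky-Papert symmetrization: [P] gives the average of [F] over the [t]-subsets of [E]. By
    linearity it suffices to treat monomials, whose average is a ratio of falling factorials, or 0
    if [Z] is not inside [E]. *)
Lemma symmetrize d F E : low_degree d F ->
  exists2 P : {poly R}, (size P <= d.+1)%N &
    forall t, (t <= #|E|)%N ->
      \sum_(Y : {set I} | (Y \subset E) && (#|Y| == t)) F Y =
        'C(#|E|, t)%:R * P.[t%:R].
Proof.
elim=> {d F} [d Z F cZ e|d a F G H _ [P sP hP] _ [Q sQ hQ] e|d F e]; last first.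
- exists 0; first by rewrite size_poly0.
  by move=> t _; rewrite horner0 mulr0 big1.
- exists (a *: P + Q).
    apply: leq_trans (size_polyD _ _) _; rewrite geq_max sQ andbT.
    exact: leq_trans (size_scale_leq _ _) sP.
  move=> t tE; rewrite hornerD hornerZ mulrDr -hQ // mulrCA -hP // mulr_sumr -big_split.
  by apply: eq_bigr => Y _; rewrite e.
have eF t : \sum_(Y : {set I} | (Y \subset E) && (#|Y| == t)) F Y =
    #|[set Y : {set I} | [&& Y \subset E, #|Y| == t & Z \subset Y]]|%:R.
  rewrite -sum1_card natr_sum big_mkcond [RHS]big_mkcond; apply: eq_bigr => Y _.
  by rewrite !inE e; case: (Y \subset E); case: (#|Y| == t); case: (Z \subset Y).
case: (boolP (Z \subset E)) => [sZE|nZE]; last first.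
  exists 0; first by rewrite size_poly0.
  move=> t _; rewrite eF horner0 mulr0 (_ : [set _ | _] = set0) ?cards0 //.
  apply/setP=> Y; rewrite !inE; apply/negbTE; apply: contra nZE => /and3P[sY _ sZ].
  exact: subset_trans sZ sY.
pose P : {poly R} := ((#|E| ^_ #|Z|)%:R)^-1 *: \prod_(i < #|Z|) ('X - (i : nat)%:R%:P).
exists P.
  apply: leq_trans (size_scale_leq _ _) _; rewrite size_prod_XsubC.
  by rewrite /index_enum -enumT size_enum_ord ltnS.
move=> t tE; rewrite eF card_draws_above // /P hornerZ horner_prod.
have -> : \prod_(i < #|Z|) ('X - (i : nat)%:R%:P).[t%:R] = (t ^_ #|Z|)%:R :> R.
  elim: #|Z| => [|z IHz]; first by rewrite big_ord0.
  rewrite big_ord_recr /= IHz ffactnSr natrM hornerXsubC.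
  case: (leqP z t) => zt; first by rewrite natrB.
  by rewrite ffact_small // mul0r mul0r.
have n0 : (#|E| ^_ #|Z|)%:R != 0 :> R.
  by rewrite pnatr_eq0 -lt0n ffact_gt0 subset_leq_card.
case: leqP => zt; last by rewrite mul0n (ffact_small zt) !mulr0.
rewrite mul1n; apply: (mulIf n0); rewrite -natrM bin_mul_ffact // natrM.
rewrite -[RHS]mulrA; congr (_ * _).
by rewrite mulrAC mulVf // mul1r.
Qed.

End SetFunctions.

(** * Extrapolation from quadratically spaced nodes *)

Section Extrapolation.
Variable R : realFieldType.
Local Open Scope ring_scope.

Lemma lagrange_eval (P : {poly R}) (d : nat) (t : 'I_d -> R) (x : R) :
    (size P <= d)%N -> injective t ->
  P.[x] = \sum_i P.[t i] * \prod_(j | j != i) ((x - t j) / (t i - t j)).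
Proof.
move=> sP injt.
pose L i := \prod_(j | j != i) ((t i - t j)^-1 *: ('X - (t j)%:P)).
have LE i y : (L i).[y] = \prod_(j | j != i) ((y - t j) / (t i - t j)).
  by rewrite horner_prod; apply: eq_bigr => j _; rewrite !hornerE mulrC.
have sL i : (size (L i) <= d)%N.
  apply: leq_trans (size_poly_prod_leq _ _) _.
  have le : (\sum_(j | j != i) size ((t i - t j)^-1 *: ('X - (t j)%:P))
      <= \sum_(j | j != i) 2)%N.
    apply: leq_sum => j _; apply: leq_trans (size_scale_leq _ _) _.
    by rewrite size_XsubC.
  have c : #|[pred j : 'I_d | j != i]| = d.-1 by rewrite cardC1 card_ord.
  have c2 : (\sum_(j < d | j != i) 2 = d.-1 * 2)%N.
    by rewrite sum_nat_const -c.
  by move: le; rewrite c c2; have := ltn_ord i; lia.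
suff /eqP : P - \sum_i P.[t i] *: L i = 0.
  rewrite subr_eq0 => /eqP {1}->; rewrite horner_sum.
  by apply: eq_bigr => i _; rewrite hornerZ LE.
apply: (@roots_geq_poly_eq0 _ _ [seq t i | i : 'I_d]).
- apply/allP => _ /mapP[i _ ->]; rewrite /root !hornerE horner_sum (bigD1 i) //=.
  rewrite hornerZ LE big1 ?mulr1 => [|j ji]; last first.
    by rewrite divff // subr_eq0 (inj_eq injt) eq_sym.
  rewrite big1 ?addr0 ?subrr // => j ji.
  by rewrite hornerZ LE (bigD1 i) 1?eq_sym //= subrr mul0r mul0r mulr0.
- by rewrite map_inj_uniq ?enum_uniq.
- rewrite size_map size_enum_ord; apply: leq_trans (size_polyD _ _) _.
  rewrite geq_max sP size_polyN; apply: leq_trans (size_sum _ _ _) _.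
  by apply/bigmax_leqP => i _; apply: leq_trans (size_scale_leq _ _) (sL i).
Qed.

(** The factors [i + j] and [i - j] surround [i]; with the tail factorial they fill [(i + r)!]. *)
Lemma prod_quad_nodes_lt (i r : nat) : (r < i)%N ->
  (\prod_(1 <= j < r.+1) ((i - j) * (i + j)) * (i * (i - r.+1)`!) = (i + r)`!)%N.
Proof.
elim: r => [|r IHr] ri.
  rewrite big_geq // mul1n addn0 subn1; case: i ri => // i _; by rewrite factS.
rewrite big_nat_recr //= -mulnA addnS factS -(IHr (ltnW ri)).
have -> : (i - r.+1 = (i - r.+2).+1)%N by clear -ri; lia.
rewrite factS; move: (\prod_(_ <= _ < _) _)%N (_ `!)%N (i + r).+1 (_ - _).+1 => A B x y.
ring.
Qed.

Lemma prod_quad_nodes_gt (i r : nat) :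
  (\prod_(i.+1 <= j < (i + r).+1) ((j - i) * (j + i)) * (i + i)`!
     = r`! * (i + r + i)`!)%N.
Proof.
elim: r => [|r IHr]; first by rewrite addn0 big_geq // mul1n fact0 mul1n.
rewrite addnS big_nat_recr /=; last by lia.
rewrite mulnAC IHr addSn !factS.
have -> : ((i + r).+1 - i = r.+1)%N by lia.
move: (r `!)%N ((i + r + i) `!)%N => A B; ring.
Qed.

(** Each increase of [i] trades the factor [d - i] for the larger [d + i + 1]. *)
Lemma fact_mul_le (d i : nat) : (i <= d)%N -> (d`! * d`! <= (d - i)`! * (d + i)`!)%N.
Proof.
elim: i => [|i IHi] id; first by rewrite subn0 addn0.
apply: leq_trans (IHi (ltnW id)) _.
have -> : (d - i = (d - i.+1).+1)%N by lia.
rewrite factS addnS factS -mulnA mulnCA leq_mul2l leq_mul2r.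
by apply/orP; right; apply/orP; right; lia.
Qed.

Lemma prod_nat_skip (d i : nat) (F : nat -> R) : (0 < i <= d)%N ->
  \prod_(1 <= j < d.+1 | j != i) F j =
    (\prod_(1 <= j < i) F j) * \prod_(i.+1 <= j < d.+1) F j.
Proof.
case/andP=> i0 id; rewrite (big_cat_nat (n := i)) //=; last by rewrite ltnW.
rewrite [X in _ * X]big_ltn_cond ?ltnS // eqxx /=; congr (_ * _);
  rewrite big_nat_cond [RHS]big_nat_cond; apply: eq_bigl => j; lia.
Qed.

(** Split at [j = i], the right product is [A * B] with [A * i = (2i - 1)!] and
    [B * (2i)! = (d - i)! (d + i)!]. Hence [2 i^2 A B = (d - i)! (d + i)!], which is at least
    [d!^2], and that is [i^2] times the left product. *)
Lemma prod_quad_nodes (d i : nat) : (0 < i <= d)%N ->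
  \prod_(1 <= j < d.+1 | j != i) (j%:R ^+ 2 : R) <=
    2 * \prod_(1 <= j < d.+1 | j != i) `|i%:R ^+ 2 - j%:R ^+ 2|.
Proof.
move=> hi; have /andP[i0 id] := hi.
have hfact : (d`! ^ 2)%N%:R = i%:R ^+ 2 * \prod_(1 <= j < d.+1 | j != i) (j%:R ^+ 2 : R).
  rewrite natrX prodrXl -exprMn; congr (_ ^+ 2).
  rewrite fact_prod natr_prod [RHS]mulrC prod_nat_skip //.
  rewrite (big_cat_nat (n := i)) //=; last by lia.
  by rewrite [X in _ * X]big_ltn ?ltnS //= mulrA mulrAC.
set A := (\prod_(1 <= j < i) ((i - j) * (i + j)))%N.
set B := (\prod_(i.+1 <= j < d.+1) ((j - i) * (j + i)))%N.
have hAB : \prod_(1 <= j < d.+1 | j != i) `|i%:R ^+ 2 - j%:R ^+ 2| = (A * B)%:R :> R.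
  rewrite prod_nat_skip // natrM !natr_prod; congr (_ * _);
    apply: eq_big_nat => j /andP[j1 j2].
    by rewrite natrM natrB ?(ltnW j2) // natrD -subr_sqr ger0_norm // subr_ge0 lerXn2r ?nnegrE ?ler_nat ?ler0n // ltnW.
  rewrite natrM natrB ?(ltnW j1) // natrD -subr_sqr distrC ger0_norm //.
  by rewrite subr_ge0 lerXn2r ?nnegrE ?ler_nat ?ler0n // ltnW.
have hA : (A * i = (i + i.-1)`!)%N.
  have /= := @prod_quad_nodes_lt i i.-1; rewrite prednK // subnn muln1 => <- //.
have hB : (B * (i + i)`! = (d - i)`! * (d + i)`!)%N.
  by have := prod_quad_nodes_gt i (d - i); rewrite subnKC.
have h2 : (d`! ^ 2 <= i ^ 2 * (2 * (A * B)))%N.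
  apply: leq_trans (fact_mul_le id) _; rewrite -hB.
  have -> : (i + i = (i + i.-1).+1)%N by lia.
  rewrite factS -hA; apply/eq_leq; nia.
rewrite hAB; move: h2; rewrite -(ler_nat R) hfact natrM natrX (natrM _ 2).
by rewrite ler_pM2l // exprn_gt0 // ltr0n.
Qed.

Lemma prod_1D_inv_sqr (d : nat) (Q : pred nat) :
  \prod_(1 <= j < d.+1 | Q j) (1 + (10 * j%:R ^+ 2)^-1) <= 5 / 4 :> R.
Proof.
have ge1 j : 1 <= 1 + (10 * j%:R ^+ 2)^-1 :> R.
  by rewrite lerDl invr_ge0 mulr_ge0 // exprn_ge0 // ler0n.
apply: le_trans (_ : \prod_(1 <= j < d.+1) (1 + (10 * j%:R ^+ 2)^-1) <= _).
  rewrite big_mkcond; apply: ler_prod => j _; case: (Q j); rewrite ?lexx ?ge1 ?ler01 ?(le_trans _ (ge1 j)) //=.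
case: d => [|d]; first by rewrite big_geq // ler_pdivlMr // ; lra.
(* The constant bound is not inductive; subtracting a multiple of the inverse of the last index
   makes room for the next factor. *)
suff : \prod_(1 <= j < d.+2) (1 + (10 * j%:R ^+ 2)^-1) <= 5 / 4 - (8 * d.+1%:R)^-1 :> R.
  by move/le_trans; apply; rewrite gerBl invr_ge0 mulr_ge0 // ler0n.
elim: d => [|d IHd]; first by rewrite big_nat1; lra.
rewrite big_nat_recr //=; apply: le_trans (ler_wpM2r _ IHd) _; first exact: le_trans (ge1 _).
rewrite -(natr1 d.+1); have : 1 <= d.+1%:R :> R by rewrite ler1n.
move: (d.+1%:R) => x x1.
rewrite -subr_ge0.
have -> : 5 / 4 - (8 * (x + 1))^-1 - (5 / 4 - (8 * x)^-1) * (1 + (10 * (x + 1) ^+ 2)^-1)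
  = (10 * (x + 1) - 10 * x + 1) / (80 * x * (x + 1) ^+ 2) :> R by field; lra.
by apply: divr_ge0; [lra|rewrite !mulr_ge0 ?exprn_ge0 //; lra].
Qed.

Lemma sum_inv_sqr (d : nat) : \sum_(1 <= i < d.+1) (i%:R ^+ 2)^-1 <= 2 :> R.
Proof.
case: d => [|d]; first by rewrite big_geq.
suff : \sum_(1 <= i < d.+2) (i%:R ^+ 2)^-1 <= 2 - d.+1%:R^-1 :> R.
  by move/le_trans; apply; rewrite gerBl invr_ge0 ler0n.
elim: d => [|d IHd]; first by rewrite big_nat1; lra.
rewrite big_nat_recr //=; apply: le_trans (lerD IHd (lexx _)) _.
rewrite -(natr1 d.+1); have : 1 <= d.+1%:R :> R by rewrite ler1n.
move: (d.+1%:R) => x x1; rewrite -subr_ge0.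
have -> : 2 - (x + 1)^-1 - (2 - x^-1 + ((x + 1) ^+ 2)^-1) = (x * (x + 1) ^+ 2)^-1 :> R.
  by field; lra.
by rewrite invr_ge0 mulr_ge0 ?exprn_ge0 //; lra.
Qed.

(** The offset 1 keeps the nodes among the positive integers, where the averages are small; the
    spacing 10 keeps the weights of the later nodes small. *)
Definition node (j : nat) : R := 1 + 10 * j%:R ^+ 2.

Lemma node_weight0 (d : nat) :
  \prod_(1 <= j < d.+1) `|(0 - node j) / (node 0 - node j)| <= 5 / 4.
Proof.
apply: le_trans (prod_1D_inv_sqr d xpredT).
rewrite le_eqVlt; apply/orP; left; apply/eqP; apply: eq_big_nat => j /andP[j1 _].
have : 1 <= j%:R :> R by rewrite ler1n.
rewrite /node; move: (j%:R) => x x1.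
have x2 : 0 < x ^+ 2 by rewrite exprn_gt0; lra.
have -> : (0 - (1 + 10 * x ^+ 2)) / (1 + 10 * 0 ^+ 2 - (1 + 10 * x ^+ 2))
   = 1 + (10 * x ^+ 2)^-1 by field; lra.
by rewrite ger0_norm // addr_ge0 // invr_ge0; lra.
Qed.

(** The factor [j = 0] is [1 / (10 i^2)]. Any other is [1 + 1 / (10 j^2)] times [j^2 / |i^2 - j^2|],
    and these multiply to at most [5/4 * 2]. *)
Lemma node_weight (d i : nat) : (0 < i <= d)%N ->
  \prod_(0 <= j < d.+1 | j != i) `|(0 - node j) / (node i - node j)|
    <= (4 * i%:R ^+ 2)^-1.
Proof.
move=> hi; have /andP[i0 id] := hi.
have i1 : 1 <= i%:R :> R by rewrite ler1n.
rewrite big_ltn_cond //= eq_sym -lt0n i0.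
have -> : `|(0 - node 0) / (node i - node 0)| = (10 * i%:R ^+ 2)^-1.
  rewrite /node; move: (i%:R) i1 => x x1.
  have x2 : 0 < x ^+ 2 by rewrite exprn_gt0; lra.
  have -> : (0 - (1 + 10 * 0 ^+ 2)) / (1 + 10 * x ^+ 2 - (1 + 10 * 0 ^+ 2))
     = - (10 * x ^+ 2)^-1 :> R by field; lra.
  by rewrite normrN ger0_norm // invr_ge0; lra.
have step (j : nat) : (1 <= j)%N -> j != i -> `|(0 - node j) / (node i - node j)| =
    (1 + (10 * j%:R ^+ 2)^-1) * (j%:R ^+ 2 * `|i%:R ^+ 2 - j%:R ^+ 2|^-1).
  move=> j1 ji; have x1 : 1 <= j%:R :> R by rewrite ler1n.
  have nz : i%:R ^+ 2 - j%:R ^+ 2 != 0 :> R.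
    by rewrite subr_eq0 eqrXn2 ?ler0n // eqr_nat eq_sym.
  rewrite /node -normfV; move: (i%:R ^+ 2) nz => y nz.
  move: (j%:R) x1 nz => x x1 nz.
  have x2 : 0 < x ^+ 2 by rewrite exprn_gt0; lra.
  have -> : (0 - (1 + 10 * x ^+ 2)) / (1 + 10 * y - (1 + 10 * x ^+ 2)) =
     - ((1 + (10 * x ^+ 2)^-1) * (x ^+ 2 * (y - x ^+ 2)^-1)) by field; lra.
  rewrite normrN normrM [X in _ * X = _]normrM (ger0_norm (ltW x2)).
  by rewrite ger0_norm // addr_ge0 // invr_ge0; lra.
have -> : \prod_(1 <= j < d.+1 | j != i) `|(0 - node j) / (node i - node j)| =
    \prod_(1 <= j < d.+1 | j != i) ((1 + (10 * j%:R ^+ 2)^-1) *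
      (j%:R ^+ 2 * `|i%:R ^+ 2 - j%:R ^+ 2|^-1)).
  rewrite big_nat_cond [RHS]big_nat_cond; apply: eq_bigr => j /andP[/andP[j1 _] ji].
  exact: step.
rewrite big_split [X in _ * (_ * X)]big_split /= prodfV.
set E := \prod_(1 <= j < d.+1 | j != i) (1 + _).
set J := \prod_(1 <= j < d.+1 | j != i) (j%:R ^+ 2).
set D := \prod_(1 <= j < d.+1 | j != i) `|_|.
have hE : E <= 5 / 4 by exact: (prod_1D_inv_sqr d (fun j => j != i)).
have hJ : J <= 2 * D by apply: prod_quad_nodes.
have D0 : 0 < D.
  rewrite /D big_nat_cond; apply: prodr_gt0 => j /andP[/andP[j1 _] ji].
  by rewrite normr_gt0 subr_eq0 eqrXn2 ?ler0n // eqr_nat eq_sym.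
have J0 : 0 <= J by apply: prodr_ge0 => j _; rewrite exprn_ge0 ?ler0n.
have hJD : J / D <= 2 by rewrite ler_pdivrMr.
have JD0 : 0 <= J / D by rewrite divr_ge0 // ltW.
have -> : (4 * i%:R ^+ 2)^-1 = (10 * i%:R ^+ 2)^-1 * (5 / 4 * 2) :> R.
  by field; lra.
apply: ler_wpM2l; first by rewrite invr_ge0 mulr_ge0 // exprn_ge0; lra.
apply: le_trans (ler_wpM2r JD0 hE) _; apply: ler_wpM2l => //; lra.
Qed.

(* Lagrange interpolation at the nodes [1 + 10 j^2], which imitate the
   Chebyshev nodes near the left endpoint: the absolute weights add up to
   at most [5/4 + 1/4 * 2 < 3]. *)
Lemma extrapolate0 (P : {poly R}) (d n : nat) :
    (size P <= d.+1)%N -> (10 * d ^ 2 < n)%N ->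
    (forall t : nat, (0 < t <= n)%N -> `|P.[t%:R]| <= 3^-1) ->
  `|P.[0]| < 1.
Proof.
move=> sP dn bP.
have inj : injective (fun j : 'I_d.+1 => node j).
  move=> a b /addrI /(mulfI (_ : 10 != 0 :> R)) h.
  apply/val_inj/eqP; rewrite -(eqr_nat R) -(eqrXn2 (n := 2)) ?ler0n //.
  by apply/eqP/h; lra.
rewrite (lagrange_eval 0 sP inj).
pose w i := \prod_(0 <= j < d.+1 | j != i) `|(0 - node j) / (node i - node j)|.
have w0 i : 0 <= w i by apply: prodr_ge0.
apply: le_lt_trans (_ : \sum_(0 <= i < d.+1) 3^-1 * w i < 1).
  rewrite big_mkord; apply: le_trans (ler_norm_sum _ _ _) _; apply: ler_sum => i _.
  rewrite normrM; apply: ler_pM => //.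
    have -> : node i = (1 + 10 * i ^ 2)%N%:R by rewrite natrD natrM natrX.
    apply: bP; rewrite add1n /=; apply: leq_trans dn.
    by rewrite ltnS leq_mul2l /= leq_exp2r // -ltnS ltn_ord.
  by rewrite normr_prod /w big_mkord.
rewrite -mulr_sumr big_nat_recl // -[\sum_(0 <= _ < _) _](big_add1 _ _ 0 d.+1 xpredT w) /=.
have e0 : w 0%N <= 5 / 4.
  rewrite /w big_ltn_cond //= (eq_bigl (fun j => (j != 0)%N)) //.
  apply: le_trans (node_weight0 d); rewrite le_eqVlt; apply/orP; left; apply/eqP.
  rewrite [LHS]big_nat_cond [RHS]big_nat_cond; apply: eq_bigl => j.
  by case: j => [|j]; rewrite /= ?andbF ?andbT.
have e1 : \sum_(1 <= i < d.+1) w i <= 4^-1 * 2.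
  apply: le_trans (_ : \sum_(1 <= i < d.+1) 4^-1 * (i%:R ^+ 2)^-1 <= _).
    rewrite big_nat_cond [X in _ <= X]big_nat_cond; apply: ler_sum => i.
    rewrite andbT => /andP[i1 id]; apply: le_trans (node_weight (d := d) _) _.
      by rewrite i1.
    by rewrite invfM.
  by rewrite -mulr_sumr ler_pM2l ?sum_inv_sqr // invr_gt0.
lra.
Qed.

End Extrapolation.

(** * Block sensitivity *)

Section MonotonePaths.
Variables (n : nat) (f : boolfun n).
Implicit Types (x y : cube n) (s : seq (cube n)).

(** [altnum] from an arbitrary starting point, so that counts add up along concatenated paths. *)
Definition altcount x s := count id (pairmap (fun a b => f a != f b) x s).

Lemma altcount_cat x s1 s2 :
  altcount x (s1 ++ s2) = altcount x s1 + altcount (last x s1) s2.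
Proof. by rewrite /altcount pairmap_cat count_cat. Qed.

Lemma altcount_ge x s : (f x != f (last x s)) <= altcount x s.
Proof.
elim: s x => [|y s IHs] x /=; first by rewrite eqxx.
rewrite /altcount /= -/(altcount y s); apply: leq_trans (_ : _ <= (f x != f y) + (f y != f (last y s))) _.
  by case: (f x); case: (f y); case: (f (last y s)).
by rewrite leq_add2l.
Qed.

Lemma mstep_path x y : (forall i, x i -> y i) ->
  exists2 s, path (@mstep n) x s & last x s = y.
Proof.
have [k] := ubnP #|[set i | ~~ x i && y i]|; elim: k x => // k IHk x lek le.
have [/existsP[i /andP[xi yi]]|/existsPn nex] := boolP [exists i, ~~ x i && y i]; last first.
  exists [::] => //=; apply/ffunP => i; have := nex i; have := le i.
  by case: (x i); case: (y i) => // /(_ isT).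
pose x' : cube n := [ffun j => if j == i then true else x j].
have [|j|s ps ls] := IHk x'.
- rewrite ltnS in lek; apply: leq_trans lek; apply: proper_card.
  apply/properP; split.
    by apply/subsetP=> j; rewrite !inE ffunE; case: eqP.
  by exists i; rewrite !inE ?xi // ffunE eqxx.
- by rewrite ffunE; case: eqP => [->|_ /le].
by exists (x' :: s) => //=; rewrite ps andbT; apply/existsP; exists i; rewrite xi eqxx.
Qed.

End MonotonePaths.

(** * Cube points indexed by pairs of sets of disjoint blocks *)

Section Blocks.
Variables (n : nat) (x : cube n) (I : finType) (B : I -> {set 'I_n}).
Implicit Types S T : {set I}.

Definition block_pt S T : cube n :=
  [ffun i => if x i then i \notin \bigcup_(j in T) B j else i \in \bigcup_(j in S) B j].

Lemma block_pt_le S T S' T' i : S \subset S' -> T' \subset T ->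
  block_pt S T i -> block_pt S' T' i.
Proof.
move=> sS sT; rewrite !ffunE; case: (x i).
  apply: contra => /bigcupP[j Tj ij]; apply/bigcupP; exists j => //.
  exact: (subsetP sT).
by case/bigcupP=> j Sj ij; apply/bigcupP; exists j => //; apply: (subsetP sS).
Qed.

Lemma block_pt0 : block_pt set0 set0 = x.
Proof. by apply/ffunP=> i; rewrite ffunE !big_set0 inE; case: (x i). Qed.

Lemma block_pt1 j : block_pt [set j] [set j] = flipB x (B j).
Proof. by apply/ffunP=> i; rewrite !ffunE !big_set1; case: (x i); case: (i \in B j). Qed.

Hypothesis disjB : forall j j' i, i \in B j -> i \in B j' -> j = j'.

(** By disjointness a coordinate lies in at most one block: membership is constant if that block is
    in [T] or does not exist, and otherwise says whether [Y] contains its index. *)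
Lemma literal_mem_blocks T i : literal (fun Y => i \in \bigcup_(j in T :|: Y) B j).
Proof.
have [iT|niT] := boolP (i \in \bigcup_(j in T) B j).
  apply: Or31; exists true => Y; have /bigcupP[j Tj ij] := iT.
  by apply/bigcupP; exists j; rewrite // inE Tj.
have [/existsP[j ij]|/existsPn nj] := boolP [exists j, i \in B j]; last first.
  by apply: Or31; exists false => Y; apply/bigcupP => -[j _]; apply/negP.
apply: Or32; exists j => Y; apply/bigcupP/idP => [[j' + ij']|Yj]; last first.
  by exists j; rewrite // inE Yj orbT.
rewrite -(disjB ij ij') inE; case/orP=> // Tj.
by case/bigcupP: niT; exists j.
Qed.

Lemma literal_negb (b : {set I} -> bool) : literal b -> literal (fun Y => ~~ b Y).
Proof.
case=> [[c e]|[j e]|[j e]].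
- by apply: Or31; exists (~~ c) => Y; rewrite e.
- by apply: Or33; exists j => Y; rewrite e.
- by apply: Or32; exists j => Y; rewrite e negbK.
Qed.

Lemma literal_block_ptl S T i : literal (fun Y => block_pt (S :|: Y) T i).
Proof.
have [xi|xi] := boolP (x i).
  by apply: Or31; exists (block_pt S T i) => Y; rewrite !ffunE xi.
have [[c e]|[j e]|[j e]] := literal_mem_blocks S i;
  [apply: Or31; exists c | apply: Or32; exists j | apply: Or33; exists j];
  by move=> Y; rewrite ffunE (negbTE xi) e.
Qed.

Lemma literal_block_ptr S T i : literal (fun Y => block_pt S (T :|: Y) i).
Proof.
have [xi|xi] := boolP (x i); last first.
  by apply: Or31; exists (block_pt S T i) => Y; rewrite !ffunE (negbTE xi).
have [[c e]|[j e]|[j e]] := literal_negb (literal_mem_blocks T i);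
  [apply: Or31; exists c | apply: Or32; exists j | apply: Or33; exists j];
  by move=> Y; rewrite ffunE xi e.
Qed.

(** Growing [S] and shrinking [T] raises the point coordinatewise, so a monotone path joins the
    endpoints of each move. The points in between can only add alternations. *)
Lemma alternates_path (f : boolfun n) l S T S' T' :
    alternates (fun S T => f (block_pt S T)) l S T S' T' ->
  exists s, [/\ path (@mstep n) (block_pt S T) s,
    last (block_pt S T) s = block_pt S' T' & l <= altcount f (block_pt S T) s].
Proof.
elim=> {l S T S' T'} [S T S' T' sS sT|l l' S T S' T' S'' T'' _ [s [ps ls cs]] _ [s' [ps' ls' cs']]].
  have [s ps ls] := mstep_path (fun i => block_pt_le (i := i) sS sT).
  by exists s; split=> //; rewrite -ls altcount_ge.
exists (s ++ s'); split; first by rewrite cat_path ps ls.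
  by rewrite last_cat ls.
by rewrite altcount_cat ls leq_add.
Qed.

End Blocks.

(** A path between arbitrary points extends at both ends to one from [zeros n] to [ones n]. *)
Lemma is_alt_path_le n (f : boolfun n) k (y : cube n) s :
  is_alt f k -> path (@mstep n) y s -> altcount f y s <= k.
Proof.
case=> _ hk ps.
have [|s1 p1 l1] := @mstep_path n (zeros n) y; first by move=> i; rewrite ffunE.
have [|s2 p2 l2] := @mstep_path n (last y s) (ones n); first by move=> i; rewrite ffunE.
have := hk (s1 ++ s ++ s2); rewrite /monpath !cat_path !last_cat l1 p1 ps p2 l2 eqxx.
move=> /(_ isT); apply: leq_trans.
by rewrite /altnum -/(altcount _ _ _) !altcount_cat l1 addnCA leq_addr.
Qed.

(** * Degree bound at an isolated corner of a subcube *)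

Section Corner.
Variables (R : realType) (n : nat) (I : finType).
Local Open Scope ring_scope.

(** The symmetrized polynomial has absolute value at least 1 at 0 and at most 1/3 at [1, ..., #|E|],
    which extrapolation forbids once [#|E|] exceeds [10 d^2]. *)
Lemma corner_card (f : boolfun n) (d : nat) (v : {set I} -> cube n) (E : {set I}) :
    Napprox R f d -> (forall i, literal (fun Y => v Y i)) -> f (v set0) ->
    (forall Y : {set I}, Y \subset E -> Y != set0 -> ~~ f (v Y)) ->
  (#|E| <= 10 * d ^ 2)%N.
Proof.
case=> p [sp hp] hv f0 fY.
have [P sP hP] := symmetrize E (low_degree_meval sp hv).
rewrite leqNgt; apply/negP => lt.
have P0 : P.[0] = p.@[cube_pt R (v set0)].
  have := hP 0%N isT; rewrite bin0 mul1r => <-.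
  rewrite (eq_bigl (pred1 set0)) ?big_pred1_eq // => Y /=.
  by rewrite cards_eq0 andb_idl // => /eqP ->; apply: sub0set.
have := hp (v set0); rewrite f0 -P0 leNgt (extrapolate0 sP lt) // => t /andP[t0 tE].
have C0 : 0 < 'C(#|E|, t)%:R :> R by rewrite ltr0n bin_gt0.
rewrite -(ler_pM2l C0) -{1}(ger0_norm (ltW C0)) -normrM -hP //.
apply: le_trans (ler_norm_sum _ _ _) _.
apply: le_trans (_ : \sum_(Y : {set I} | (Y \subset E) && (#|Y| == t)) 3^-1 <= _).
  apply: ler_sum => Y /andP[sY /eqP cY]; have := hp (v Y).
  rewrite (negbTE (fY _ sY _)) //.
  by rewrite -card_gt0 cY.
by rewrite sumr_const -cards_draws cardsE mulr_natl.
Qed.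

End Corner.

Lemma Napprox0_const (R : realType) n (f : boolfun n) x y : Napprox R f 0 -> f x = f y.
Proof.
case=> p [/msize1_polyC -> hp]; have := hp x; have := hp y.
rewrite !mevalC; case: (f x); case: (f y) => // h1 h2; exfalso; lra.
Qed.

Lemma bs_at_le (R : realType) n (f : boolfun n) (k d0 d1 : nat) (x : cube n) :
    is_alt f k -> Napprox R f d0 -> Napprox R (negf f) d1 ->
  bs_at f x <= 2 * (10 * maxn d0 d1 ^ 2) * k.
Proof.
move=> hk h0 h1; apply/bigmax_leqP => F /and3P[/trivIsetP tF _ /forall_inP hF].
set d := maxn d0 d1.
have [F0|/set0Pn[B0 FB0]] := eqVneq F set0; first by rewrite F0 cards0.
(* A sensitive block shows that [f] is not constant, which excludes degree 0 and makes the loss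
   bound [10 * d ^ 2] positive. *)
have d_gt0 : 0 < d.
  rewrite lt0n; apply: contraTneq (hF _ FB0) => d0'.
  have d00 : d0 = 0 by move: d0'; rewrite /d; lia.
  by rewrite negbK; apply/eqP; apply: (@Napprox0_const R); rewrite -d00.
pose I : finType := {B : {set 'I_n} | B \in F}.
pose bl (j : I) := val j.
have disj (j j' : I) i : i \in bl j -> i \in bl j' -> j = j'.
  move=> ij ij'; apply/val_inj/eqP; apply: contraTT ij' => ne.
  have := tF _ _ (valP j) (valP j') ne.
  by move=> dis; rewrite (disjointFr dis ij).
pose g (S T : {set I}) := f (block_pt x bl S T).
(* Whichever of [f] and [negf f] is true at the base point supplies the polynomial; this is why the
   larger of the two degrees appears. *)
have corner (v : {set I} -> cube n) (X : {set I}) :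
    (forall i, literal (fun Y => v Y i)) ->
    (forall Y : {set I}, Y \subset X -> Y != set0 -> f (v Y) = ~~ f (v set0)) ->
    #|X| <= 10 * d ^ 2.
  move=> hv hX; case E: (f (v set0)) in hX.
    apply: leq_trans (corner_card h0 hv E _) _ => [Y sY nY|]; first by rewrite hX.
    by rewrite leq_mul2l leq_exp2r // leq_maxl.
  apply: leq_trans (corner_card h1 hv _ _) _ => [|Y sY nY|]; rewrite /negf ?E ?hX //.
  by rewrite leq_mul2l leq_exp2r // leq_maxr.
have [|S T X hX|S T X hX|j|l rl cI] := @block_alternates I g (10 * d ^ 2).
- by rewrite muln_gt0 expn_gt0 d_gt0.
- apply: (corner (fun Y => block_pt x bl S (T :|: Y))) => [i|Y sY nY].
    exact: literal_block_ptr.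
  by rewrite setU0; apply: hX.
- apply: (corner (fun Y => block_pt x bl (S :|: Y) T)) => [i|Y sY nY].
    exact: literal_block_ptl.
  by rewrite setU0; apply: hX.
- rewrite /g block_pt0 block_pt1; have := hF _ (valP j); rewrite -/(bl j).
  by case: (f x); case: (f _).
have -> : #|F| = #|I| by rewrite card_sig; apply: eq_card => B; rewrite inE.
apply: leq_trans cI _; rewrite leq_mul2l; apply/orP; right.
have [s [ps _ ls]] := alternates_path rl.
exact: leq_trans ls (is_alt_path_le hk ps).
Qed.

Theorem theorem3p13 :
  exists C : nat, forall (R : realType) (n : nat) (f : boolfun n) (k d0 d1 : nat),
    is_alt f k -> is_N R f d0 -> is_N R (negf f) d1 ->
    (bs f <= C * (k * (maxn d0 d1) ^ 2))%N.
Proof.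
exists 20 => R n f k d0 d1 hk [h0 _] [h1 _].
apply/bigmax_leqP => x _; apply: leq_trans (bs_at_le x hk h0 h1) _.
by rewrite mulnA mulnAC -mulnA [k * _]mulnC !mulnA.
Qed.
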